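(* Let $M\ge1$ be an integer, let $\mathcal U$ be the set of bases $q>1$ in which $x=1$ has exactly one expansion over the alphabet $\{0,1,\ldots,M\}$, and let $\overline{\mathcal U}$ be the closure of $\mathcal U$ in $\mathbb R$. Then: (i) $\mathcal U$ and $\overline{\mathcal U}$ have Lebesgue measure zero. (ii) $\mathcal U$ and $\overline{\mathcal U}$ have Hausdorff dimension one.
   Context: For a real base $q>1$, an expansion of a real number $x$ in base $q$ is a sequence $(c_i)\in\{0,1,\ldots,M\}^\infty$ with $\sum_{i=1}^\infty c_i q^{-i}=x$. *)

(* Defs.v *)
From HB Require Import structures.
From mathcomp Require Import all_boot all_order all_algebra.
From mathcomp Require Import all_classical all_reals all_analysis.

Set Implicit Arguments.
Unset Strict Implicit.
Unset Printing Implicit Defensive.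

Import Order.TTheory GRing.Theory Num.Theory.
Import numFieldNormedType.Exports.

Local Open Scope classical_set_scope.
Local Open Scope ring_scope.

(* The digit written c_i (i >= 1) on paper is [c i.-1] here, whence the
   exponent [i.+1]. *)
Definition is_expansion (R : realType) (M : nat) (q x : R)
    (c : nat -> 'I_M.+1) : Prop :=
  series (fun i : nat => (c i : nat)%:R / q ^+ i.+1) @ \oo --> x.

Definition univoque_bases (R : realType) (M : nat) : set R :=
  [set q : R | 1 < q /\ exists! c : nat -> 'I_M.+1, is_expansion q 1 c].
Arguments univoque_bases R M : clear implicits.

(* The point 0 is adjoined only so that the empty set has diameter 0:
   [ereal_sup set0] is -oo. *)
Definition diam (R : realType) (A : set R) : \bar R :=
  ereal_sup (0%E |` [set e : \bar R | exists x y : R,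
    [/\ A x, A y & e = (`|x - y|)%:E]]).

(* |A|^s, with the usual conventions |set0|^s = 0 for every s >= 0 and
   |{x}|^0 = 1; [poweR] gives 1 to every base at exponent 0. *)
Definition diam_pow (R : realType) (s : R) (A : set R) : \bar R :=
  if `[< A = set0 >] then 0%E else poweR (diam A) s.

Definition delta_cover (R : realType) (d : R) (A : set R) :
    set (nat -> set R) :=
  [set F | A `<=` \bigcup_k F k /\ forall k, (diam (F k) <= d%:E)%E].

Definition hausdorff_premeasure (R : realType) (s d : R) (A : set R) :
    \bar R :=
  ereal_inf [set (\sum_(0 <= k <oo) diam_pow s (F k))%E | F in delta_cover d A].

Definition hausdorff_measure (R : realType) (s : R) (A : set R) : \bar R :=
  ereal_sup [set hausdorff_premeasure s d A | d in [set d : R | 0 < d]].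

Definition hausdorff_dim (R : realType) (A : set R) : \bar R :=
  ereal_inf [set s%:E | s in
    [set s : R | 0 <= s /\ hausdorff_measure s A = 0%E]].

(* Main.v *)
Require Import Defs.
From HB Require Import structures.
From mathcomp Require Import all_boot all_order all_algebra.
From mathcomp Require Import all_classical all_reals all_analysis.
From mathcomp Require Import zify ring lra.
Import Order.TTheory GRing.Theory Num.Theory.
Import numFieldNormedType.Exports.
Local Open Scope classical_set_scope.
Local Open Scope ring_scope.

(** Write r_n(x) for the remainder x^n (1 - sum_(i <= n) c_i x^-i), so that
    r_0 = 1 and r_(n+1)(x) = x r_n(x) - c_(n+1); c is an expansion of 1 in base
    x iff all r_n(x) lie in [0, M/(x-1)].

    Measure. If c has a nonzero digit among the first n and
    0 <= r_n(x) <= M/(x-1) - 1, then x is not univoque, since the last nonzero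
    digit can be kept or lowered by one.  Let c be the expansion of 1 in a
    univoque base x0 and l the root of r_n to the left of x0.  On [l, x0] the
    function r_n is convex and increases from 0 to a bounded value, so a fixed
    proportion of this interval, next to l, contains no univoque base.  As
    x0 - l is exponentially small in n, the closure of U is porous at each of
    its points in (1, M+1), and Lebesgue's density theorem applies.

    Dimension. Sequences M^(2N) (0 w_1 M) (0 w_2 M) ..., with arbitrary words
    w_i of length N - 2, are unique expansions of 1 in some base q.  Reading
    w_1 w_2 ... in base M+1 maps these bases onto [0, 1], and this map is
    Hoelder continuous with exponent (N-2)/N.  A cover of U thus yields a
    cover of [0, 1], which bounds the s-dimensional measure of U from below
    whenever s <= (N-2)/N. *)

(** * Remainders and expansions *)

(** The start value [y] is a parameter because tails of expansions and reflected digit sequences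
    start from values other than 1. *)
Fixpoint remainder {R : realType} {M : nat} (c : nat -> 'I_M.+1) (x y : R)
    (n : nat) : R :=
  if n is n'.+1 then x * remainder c x y n' - (c n')%:R else y.

Lemma digit_le {R : realType} {M : nat} (d : 'I_M.+1) : (d%:R : R) <= M%:R.
Proof. by rewrite ler_nat -ltnS ltn_ord. Qed.

Lemma remainderE {R : realType} {M : nat} (c : nat -> 'I_M.+1) (x y : R) n :
  x != 0 ->
  remainder c x y n
  = x ^+ n * (y - series (fun i => (c i : nat)%:R / x ^+ i.+1) n).
Proof.
move=> x0; elim: n => [|n IH] /=; first by rewrite seriesEnat /= big_geq //; ring.
rewrite IH seriesEnat /= big_nat_recr //= !exprS.
have xn0 : x ^+ n != 0 by rewrite expf_neq0.
by field; apply/andP.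
Qed.

Lemma eq_remainder {R : realType} {M : nat} (c d : nat -> 'I_M.+1) (x y : R) n :
  (forall i, (i < n)%N -> c i = d i) -> remainder c x y n = remainder d x y n.
Proof.
elim: n => [//|n IH] h /=; rewrite IH ?h // => i hi.
by apply: h; exact: ltnW.
Qed.

Lemma remainder_sub {R : realType} {M : nat} (c : nat -> 'I_M.+1) (x y y' : R) n :
  remainder c x y n - remainder c x y' n = x ^+ n * (y - y').
Proof.
elim: n => [|n IH] /=; first by rewrite mul1r.
by rewrite exprS -mulrA -IH; ring.
Qed.

Lemma remainder_ge0W {R : realType} {M : nat} (c : nat -> 'I_M.+1) (x y : R) k n :
  0 < x -> (k <= n)%N -> 0 <= remainder c x y n -> 0 <= remainder c x y k.
Proof.
move=> x0; elim: n => [|n IH]; first by rewrite leqn0 => /eqP ->.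
rewrite leq_eqVlt => /predU1P[-> //|kn] /=; rewrite subr_ge0 => h.
apply: IH => //; rewrite -(pmulr_rge0 _ x0).
exact: le_trans h.
Qed.

(** The partial sums S_n increase to y, while S_n plus the largest possible tail, M/(x-1) times
    x^-n, decreases to y. *)
Lemma expansion_remainder {R : realType} {M : nat} (c : nat -> 'I_M.+1) (x y : R) :
  1 < x -> is_expansion x y c ->
  forall n, 0 <= remainder c x y n <= M%:R / (x - 1).
Proof.
move=> x1 hc n; have x0 : 0 < x by lra.
have xn0 k : 0 < x ^+ k by rewrite exprn_gt0.
rewrite remainderE ?gt_eqF //; move: hc; rewrite /is_expansion.
set S := series _ => hc.
have lower : S n <= y.
  rewrite -(cvg_lim _ hc)//; apply: nondecreasing_cvgn_le; last exact: cvgP hc.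
  apply: nondecreasing_series => i _ _; rewrite divr_ge0 ?ler0n ?ltW //.
have upper : y <= S n + (M%:R / (x - 1)) * (x ^+ n)^-1.
  pose T := S \+ (fun k => (M%:R / (x - 1)) * (x ^+ k)^-1).
  have Tc : T @ \oo --> y.
    rewrite -[y]addr0; apply: cvgD => //.
    have := @cvg_geometric R (M%:R / (x - 1)) x^-1.
    rewrite ger0_norm ?invr_ge0 ?ltW // invf_lt1 // => /(_ x1).
    rewrite /geometric /=; apply: cvg_trans; apply: near_eq_cvg.
    by near=> k; rewrite exprVn.
  rewrite -(cvg_lim _ Tc) //; apply: (@nonincreasing_cvgn_ge _ T); last exact: cvgP Tc.
  apply/nonincreasing_seqP => k; rewrite /T /S /= !seriesEnat /= big_nat_recr //= -addrA lerD2l.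
  have -> : M%:R / (x - 1) / x ^+ k = M%:R / x ^+ k.+1 + M%:R / (x - 1) / x ^+ k.+1.
    rewrite exprS; field; rewrite !gt_eqF // subr_gt0 //.
  by rewrite lerD2r ler_pM2r ?invr_gt0 // digit_le.
apply/andP; split; first by apply: mulr_ge0; [exact: ltW | lra].
rewrite mulrC -ler_pdivlMr //; lra.
Unshelve. all: end_near.
Qed.

(** The error of the n-th partial sum is r_n / x^n, which tends to 0 as soon as r_n is eventually
    bounded. *)
Lemma remainder_expansion {R : realType} {M : nat} (c : nat -> 'I_M.+1) (x y C : R) n0 :
  1 < x -> (forall n, (n0 <= n)%N -> 0 <= remainder c x y n <= C) ->
  is_expansion x y c.
Proof.
move=> x1 h; have x0 : 0 < x by lra.
have xn0 k : 0 < x ^+ k by rewrite exprn_gt0.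
rewrite /is_expansion; set S := series _.
have SE n : S n = y - remainder c x y n * (x ^+ n)^-1.
  rewrite remainderE ?gt_eqF // -/S; field; exact: lt0r_neq0.
have h0 : (fun n => y - C * (x ^+ n)^-1) @ \oo --> y.
  rewrite -[X in _ --> X]subr0; apply: cvgB; first exact: cvg_cst.
  have := @cvg_geometric R C x^-1.
  rewrite ger0_norm ?invr_ge0 ?ltW // invf_lt1 // => /(_ x1).
  rewrite /geometric /=; apply: cvg_trans; apply: near_eq_cvg.
  by near=> k; rewrite exprVn.
apply: (@squeeze_cvgr _ _ _ _ (fun n => y - C * (x ^+ n)^-1) (fun=> y)) => //; last exact: cvg_cst.
near=> n; rewrite SE.
have /h /andP[a b] : (n0 <= n)%N by near: n; exists n0.
apply/andP; split.
  by rewrite lerD2l lerN2 ler_pM2r ?invr_gt0.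
by rewrite gerBl mulr_ge0 // invr_ge0 ltW.
Unshelve. all: end_near.
Qed.

(** Greedy algorithm: from t in [0, B], with B = M/(x-1), take the digit min(M, floor(x t)). The new
    value stays in [0, B], because x B - M = B and because x <= M+1 gives B >= 1. *)
Lemma expansion_exists {R : realType} {M : nat} (x y : R) :
  1 < x <= M%:R + 1 -> 0 <= y <= M%:R / (x - 1) ->
  exists c : nat -> 'I_M.+1, is_expansion x y c.
Proof.
move=> /andP[x1 xM] hy; set B := M%:R / (x - 1).
have x10 : 0 < x - 1 by lra.
have BE : B * (x - 1) = M%:R by rewrite /B divfK // gt_eqF.
have B1 : 1 <= B by rewrite /B ler_pdivlMr //; lra.
have step (t : R) : exists d : 'I_M.+1, 0 <= t <= B -> 0 <= x * t - d%:R <= B.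
  have [ht|ht] := boolP (0 <= t <= B); last by exists ord0.
  case/andP: ht => t0 tB.
  have xt0 : 0 <= x * t by rewrite mulr_ge0 //; lra.
  have [hl|hl] := leP (M%:R) (x * t).
    exists ord_max => _ /=; apply/andP; split; first lra.
    have : x * t <= x * B by rewrite ler_pM2l //; lra.
    lra.
  have /andP[a b] := truncn_itv xt0.
  have hM : (Num.trunc (x * t) < M.+1)%N.
    by rewrite ltnS -(@ler_nat R); apply: ltW; apply: le_lt_trans hl.
  exists (Ordinal hM) => _ /=; move: b; rewrite -natr1; lra.
have [g gP] := choice step.
pose fix z n := if n is n'.+1 then x * z n' - (g (z n'))%:R else y.
pose c n := g (z n).
have zE n : remainder c x y n = z n by elim: n => [//|n IH] /=; rewrite IH.
exists c; apply: (@remainder_expansion _ _ _ _ _ B 0%N) => // n _; rewrite zE.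
elim: n => [//|n IH] /=; exact: gP.
Qed.

(** The digits from n on are replaced by an expansion of the remainder r_n itself. *)
Lemma splice_expansion {R : realType} {M : nat} (c : nat -> 'I_M.+1) (x y : R) n :
  1 < x <= M%:R + 1 -> 0 <= remainder c x y n <= M%:R / (x - 1) ->
  exists d : nat -> 'I_M.+1,
    (forall i, (i < n)%N -> d i = c i) /\ is_expansion x y d.
Proof.
move=> hx /(expansion_exists _ _ hx)[e he].
have /andP[x1 _] := hx.
pose d i := if (i < n)%N then c i else e (i - n)%N.
have dc i : (i < n)%N -> d i = c i by rewrite /d => ->.
exists d; split=> //.
apply: (@remainder_expansion _ _ _ _ _ (M%:R / (x - 1)) n) => // m nm.
rewrite -(subnKC nm).
have -> : remainder d x y (n + (m - n)) = remainder e x (remainder c x y n) (m - n).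
  elim: (m - n)%N => [|k IH]; first by rewrite addn0; exact: eq_remainder.
  by rewrite addnS /= IH /d ltnNge leq_addr /= addKn.
exact: expansion_remainder.
Qed.

(* Lowering the last nonzero digit raises the remainder by 1, which is still
   small enough to be expanded; hence two expansions. *)
Lemma remainder_gap_digit {R : realType} {M : nat} (c : nat -> 'I_M.+1) (x : R) n :
  1 < x <= M%:R + 1 -> (0 < c n)%N ->
  0 <= remainder c x 1 n.+1 <= M%:R / (x - 1) - 1 -> ~ univoque_bases R M x.
Proof.
move=> hx cn /andP[r0 rB] [_ [e [_ eU]]].
have [d [dc dE]] : exists d : nat -> 'I_M.+1,
    (forall i, (i < n.+1)%N -> d i = c i) /\ is_expansion x 1 d.
  by apply: splice_expansion => //; apply/andP; split => //; lra.
have cn' : ((c n).-1 < M.+1)%N by rewrite prednK // ltnW.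
pose c' i := if i == n then Ordinal cn' else c i.
have rc' : remainder c' x 1 n.+1 = remainder c x 1 n.+1 + 1.
  rewrite /= (@eq_remainder _ _ c' c); last first.
    by move=> i hi; rewrite /c' ltn_eqF.
  by rewrite /c' eqxx /= -[in RHS](prednK cn) -natr1; ring.
have [d' [dc' dE']] : exists d : nat -> 'I_M.+1,
    (forall i, (i < n.+1)%N -> d i = c' i) /\ is_expansion x 1 d.
  by apply: splice_expansion => //; rewrite rc'; apply/andP; split; lra.
have : d n = d' n by rewrite -(eU _ dE) -(eU _ dE').
rewrite dc // dc' // /c' eqxx => /(congr1 val) /= ce.
by move: cn ce; lia.
Qed.

(** Reduction to the last nonzero digit: across a zero digit r_(n+1) = x r_n, so the window for
    r_(n+1) is inherited by the smaller r_n. *)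
Lemma remainder_gap {R : realType} {M : nat} (c : nat -> 'I_M.+1) (x : R) n :
  1 < x <= M%:R + 1 -> (exists2 i, (i < n)%N & (0 < c i)%N) ->
  0 <= remainder c x 1 n <= M%:R / (x - 1) - 1 -> ~ univoque_bases R M x.
Proof.
move=> hx; elim: n => [[//]|n IH] [i hi ci] hr.
have [cn|] := ltnP 0 (c n); first exact: remainder_gap_digit hr.
rewrite leqn0 => /eqP cn.
apply: IH.
  exists i => //; move: hi; rewrite ltnS leq_eqVlt => /predU1P[ein|//].
  by rewrite ein cn in ci.
move: hr; rewrite /= cn subr0; have /andP[x1 xM] := hx.
have x0 : 0 < x by lra.
rewrite pmulr_rge0 // => /andP[r0 rB]; rewrite r0 /=; apply: le_trans rB.
by rewrite ler_peMl // ltW.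
Qed.

Lemma univoque_bases_bounds {R : realType} {M : nat} (x : R) :
  univoque_bases R M x -> 1 < x <= M%:R + 1.
Proof.
move=> [x1 [c [cE _]]]; rewrite x1 /=.
have := expansion_remainder _ _ _ x1 cE 0%N => /andP[_] /=.
by rewrite ler_pdivlMr ?subr_gt0 //; lra.
Qed.

(** * Porosity and measure zero *)

Lemma remainder_homo {R : realType} {M : nat} (c : nat -> 'I_M.+1) (l x y : R) n :
  0 < l <= x -> 0 <= remainder c l y n -> remainder c l y n <= remainder c x y n.
Proof.
move=> /andP[l0 lx]; elim: n => [//|n IH] h /=; rewrite lerD2r.
have r0 : 0 <= remainder c l y n by apply: remainder_ge0W h.
by apply: ler_pM => //; [exact: ltW | exact: IH].
Qed.

(** Convexity of r_n to the right of l, as a chord inequality without division. It passes from n to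
    n+1 because r_n is nonnegative and increasing there. *)
Lemma remainder_chord {R : realType} {M : nat} (c : nat -> 'I_M.+1) (l x z y : R) n :
  0 < l -> l <= x <= z -> 0 <= remainder c l y n ->
  (z - l) * (remainder c x y n - remainder c l y n)
  <= (x - l) * (remainder c z y n - remainder c l y n).
Proof.
move=> l0 /andP[lx xz]; elim: n => [|n IH] h /=; first by rewrite !subrr !mulr0.
have r0 : 0 <= remainder c l y n by apply: remainder_ge0W h.
have lz : 0 < l <= z by rewrite l0 (le_trans lx).
have rz := remainder_homo c _ _ y n lz r0.
have {IH}IH := IH r0.
have h1 : x * ((z - l) * (remainder c x y n - remainder c l y n))
   <= x * ((x - l) * (remainder c z y n - remainder c l y n)).
  by rewrite ler_wpM2l //; lra.
have h2 : x * ((x - l) * (remainder c z y n - remainder c l y n))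
   <= z * ((x - l) * (remainder c z y n - remainder c l y n)).
  by rewrite ler_wpM2r // mulr_ge0 // subr_ge0.
by nra.
Qed.

(** Each step adds (x - l) r_n(l) >= 0 to x (r_n(x) - r_n(l)). Since remainders are bounded, this
    makes x - l exponentially small. *)
Lemma remainder_growth {R : realType} {M : nat} (c : nat -> 'I_M.+1) (l x : R) n :
  0 < l <= x -> 0 <= remainder c l 1 n.+1 ->
  x ^+ n * (x - l) <= remainder c x 1 n.+1 - remainder c l 1 n.+1.
Proof.
move=> lx; have /andP[l0 lx'] := lx; elim: n => [|n IH] h; first by rewrite /=; lra.
have r0 : 0 <= remainder c l 1 n.+1 by apply: remainder_ge0W h.
have {IH} := IH r0.
rewrite [remainder _ x _ n.+2]/= [remainder _ l _ n.+2]/= -!/(remainder _ _ _ n.+1).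
move: r0; move: (remainder c x 1 n.+1) (remainder c l 1 n.+1) => u v v0 IH.
have : x * (x ^+ n * (x - l)) <= x * (u - v) by rewrite ler_wpM2l //; lra.
have : 0 <= (x - l) * v by rewrite mulr_ge0 //; lra.
by rewrite exprS; lra.
Qed.

(** The difference obeys u' = x u + (x - z) r_n(z), with x <= M+1 and |r_n(z)| <= C. The constant
    K_n = C ((M+1)^n - 1) satisfies (M+1) K_n + C <= K_(n+1) as M >= 1. *)
Lemma remainder_lipschitz {R : realType} {M : nat} (c : nat -> 'I_M.+1)
    (C x z y : R) n :
  (1 <= M)%N -> 0 <= x <= M%:R + 1 ->
  (forall i, (i < n)%N -> `|remainder c z y i| <= C) ->
  `|remainder c x y n - remainder c z y n|
  <= C * ((M%:R + 1) ^+ n - 1) * `|x - z|.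
Proof.
move=> M1 /andP[x0 xM]; elim: n => [|n IH] h /=.
  by rewrite !subrr normr0 mulr0 mul0r.
have {}IH := IH (fun i hi => h i (ltnW hi)).
have {}h := h n (ltnSn n).
have C0 : 0 <= C by apply: le_trans h.
have M1' : 1 <= M%:R :> R by rewrite ler1n.
set u := remainder c x y n in IH *; set v := remainder c z y n in IH h *.
have -> : x * u - (c n)%:R - (z * v - (c n)%:R) = x * (u - v) + (x - z) * v by ring.
apply: (le_trans (ler_normD _ _)); rewrite !normrM (ger0_norm x0).
have h1 : x * `|u - v| <= (M%:R + 1) * (C * ((M%:R + 1) ^+ n - 1) * `|x - z|).
  by apply: ler_pM.
have h2 : `|x - z| * `|v| <= `|x - z| * C by rewrite ler_wpM2l.
apply: (le_trans (lerD h1 h2)); rewrite exprS.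
have : 0 <= C * `|x - z| * (M%:R - 1) by rewrite !mulr_ge0 // subr_ge0.
by lra.
Qed.

Lemma exists_lt_exp {R : realType} (C a : R) : 1 < a -> exists n, C < a ^+ n.
Proof.
move=> a1; have a10 : 0 < a - 1 by lra.
exists (Num.trunc (C / (a - 1))).+1.
have := truncnS_gt (C / (a - 1)); rewrite ltr_pdivrMr // => h; apply: lt_le_trans h _.
elim: (_.+1) => [|n IH]; first by rewrite mul0r expr0.
have : 1 <= a ^+ n by rewrite exprn_ege1 // ltW.
by rewrite exprS -natr1; nra.
Qed.

Lemma remainder_continuous {R : realType} {M : nat} (c : nat -> 'I_M.+1) (y : R) n :
  continuous (fun x => remainder c x y n).
Proof.
elim: n => [|n IH] x /=; first exact: cvg_cst.
by apply: cvgB; [apply: cvgM; [exact: cvg_id | exact: IH] | exact: cvg_cst].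
Qed.

(** At x = 1 the remainder is 1 minus the digit sum; this gives the sign needed to find a root of
    r_n. *)
Lemma remainder_at1 {R : realType} {M : nat} (c : nat -> 'I_M.+1) n :
  (exists2 i, (i < n)%N & (0 < c i)%N) -> remainder c (1 : R) 1 n <= 0.
Proof.
have le1 k : remainder c (1 : R) 1 k <= 1.
  elim: k => [//|k IH] /=; rewrite mul1r.
  have : 0 <= (c k)%:R :> R by []. by lra.
elim: n => [[]//|n IH] [i hi ci] /=; rewrite mul1r.
have [cn|cn] := posnP (c n).
  rewrite cn subr0; apply: IH; exists i => //.
  by move: hi; rewrite ltnS leq_eqVlt => /predU1P[ein|//]; rewrite ein cn in ci.
have : 1 <= (c n)%:R :> R by rewrite ler1n.
by have := le1 n; lra.
Qed.

Lemma remainder_all0 {R : realType} {M : nat} (c : nat -> 'I_M.+1) (x y : R) n :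
  (forall i, (i < n)%N -> c i = 0%N :> nat) -> remainder c x y n = x ^+ n * y.
Proof.
elim: n => [|n IH] h /=; first by rewrite mul1r.
by rewrite h // subr0 IH ?exprS ?mulrA // => i hi; apply: h; exact: ltnW.
Qed.

(** At arbitrarily small radii r, the ball about [q] contains an interval of length [d * r] free of
    [K], with [d] independent of r. *)
Definition porous_at {R : realType} (K : set R) (q : R) : Prop :=
  exists2 d : R, 0 < d & forall r0 : R, 0 < r0 -> exists r l : R,
    [/\ 0 < r < r0, q - r < l, l + d * r < q + r &
        forall x, l < x < l + d * r -> ~ K x].

Lemma univoque_closure_porous {R : realType} {M : nat} (q : R) :
  (1 <= M)%N -> 1 < q < M%:R + 1 -> closure (univoque_bases R M) q ->
  porous_at (univoque_bases R M) q.
Proof.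
move=> M1 /andP[q1 qM] clq.
have M1' : 1 <= M%:R :> R by rewrite ler1n.
pose a := (1 + q) / 2; pose b := (q + M%:R + 1) / 2.
have [a1 aq qb bM] : [/\ 1 < a, a < q, q < b & b < M%:R + 1] by rewrite /a /b; split; lra.
(* On [a, b] these are uniform bounds: e for the width of the gap window from below, C for the
   remainders from above. *)
pose e := M%:R / (b - 1) - 1; pose C := M%:R / (a - 1).
have e0 : 0 < e by rewrite /e subr_gt0 ltr_pdivlMr; lra.
have C0 : 0 < C by rewrite divr_gt0 //; lra.
have BW x : a <= x <= b -> e <= M%:R / (x - 1) - 1 /\ M%:R / (x - 1) <= C.
  move=> /andP[ax xb]; split.
    by rewrite /e lerD2r ler_pM2l ?lef_pV2 ?posrE; lra.
  by rewrite /C ler_pM2l ?lef_pV2 ?posrE; lra.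
have eC : e < C.
  have /BW[h1 h2] : a <= q <= b by rewrite (ltW aq) (ltW qb).
  lra.
(* With h = x0 - l, the radius will be r = 3h and the gap ]l, l + (e/C) h[, whence d = e/(3C). *)
exists (e / (3 * C)); first by rewrite divr_gt0 // mulr_gt0.
move=> r0 r00.
(* The summand C forces a nonzero digit among the first n; the summand C/(r0/3) forces h < r0/3. *)
have [k kC] := exists_lt_exp (C + C / (r0 / 3)) a a1.
pose n := k.+1; pose L := C * (M%:R + 1) ^+ n.
have L0 : 0 < L by rewrite mulr_gt0 // exprn_gt0 //; lra.
(* The Lipschitz bound will give h > e/L, so taking x0 within e/L of q ensures |q - x0| < h. *)
pose rho := Num.min (e / L) (Num.min (q - a) (b - q)).
have rho0 : 0 < rho by rewrite !lt_min divr_gt0 //=; lra.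
have [x0 [Ux0]] := clq _ (nbhsx_ballx q rho rho0).
rewrite /ball /= !lt_min => /and3P[x0L x0a x0b].
have {x0a} ax0 : a < x0 by move: x0a; rewrite ltr_norml; lra.
have {x0b} x0b' : x0 < b by move: x0b; rewrite ltr_norml; lra.
have [Be BC] : e <= M%:R / (x0 - 1) - 1 /\ M%:R / (x0 - 1) <= C by apply: BW; rewrite (ltW ax0) (ltW x0b').
have x01 : 1 < x0 by lra.
have [_ [c [cE _]]] := Ux0.
have cr := expansion_remainder _ _ _ x01 cE.
have aC : C < a ^+ k.
  by apply: lt_trans kC; rewrite ltrDl divr_gt0 // divr_gt0.
have ax0k j : a ^+ j <= x0 ^+ j by rewrite lerXn2r ?nnegrE; lra.
have nz : exists2 i, (i < n)%N & (0 < c i)%N.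
  apply: contrapT => hn.
  have z : forall i, (i < n)%N -> c i = 0%N :> nat.
    move=> i hi; apply/eqP; rewrite -leqn0 leqNgt; apply/negP => hc.
    by apply: hn; exists i.
  have := cr n; rewrite remainder_all0 // mulr1 => /andP[_].
  have := ax0k n; have : a ^+ k <= a ^+ n by rewrite ler_weXn2l // ltW.
  lra.
(* As x0 is univoque, its remainder must lie above the forbidden window. *)
have en : e < remainder c x0 1 n.
  rewrite ltNge; apply/negP => h; apply: (remainder_gap c x0 n) Ux0 => //.
    by apply/andP; split; lra.
  by have /andP[-> _] := cr n; rewrite (le_trans h).
have [l lI l0] : exists2 l, l \in `[1, x0] & remainder c l 1 n = 0.
  apply: IVT; [exact: ltW | | ].
    by apply: continuous_subspaceT; exact: remainder_continuous.
  rewrite ge_min le_max remainder_at1 //.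
  by rewrite (ltW (lt_trans e0 en)) orbT.
move: lI; rewrite in_itv /= => /andP[l1 lx0].
have l0' : 0 < l by lra.
have lpos : 0 < l <= x0 by rewrite l0'.
have rl : 0 <= remainder c l 1 n by rewrite l0.
pose h := x0 - l.
have hup : a ^+ k * h <= C.
  apply: le_trans (_ : x0 ^+ k * h <= _); first by rewrite ler_wpM2r // subr_ge0.
  apply: le_trans (remainder_growth c l x0 k lpos rl) _.
  rewrite -/n l0 subr0; have /andP[_ hr] := cr n; exact: le_trans BC.
have hlo : e < L * h.
  apply: (lt_le_trans en).
  have := remainder_lipschitz c C x0 l 1 n M1.
  rewrite l0 subr0 (ger0_norm (ltW (lt_trans e0 en))) ger0_norm ?subr_ge0 // => hL.
  apply: le_trans (hL _ _) _.
  - by apply/andP; split; lra.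
  - move=> i hi.
    have ri : 0 <= remainder c l 1 i by apply: remainder_ge0W rl => //; exact: ltnW.
    rewrite ger0_norm //; apply: le_trans (remainder_homo c l x0 1 i lpos ri) _.
    by have /andP[_ hr] := cr i; apply: le_trans BC.
  - rewrite ler_wpM2r ?subr_ge0 // ler_wpM2l ?(ltW C0) //.
    by rewrite gerBl.
have h0 : 0 < h by rewrite -(pmulr_rgt0 _ L0) (lt_trans e0).
have qx0 : `|q - x0| < h by apply: lt_trans x0L _; rewrite ltr_pdivrMr // mulrC.
have hr0 : h < r0 / 3.
  have h3 : (C + C / (r0 / 3)) * h < C.
    by apply: lt_le_trans hup; rewrite ltr_pM2r.
  have : C / (r0 / 3) * h < C by apply: le_lt_trans h3; rewrite ler_pM2r // lerDr ltW.
  by rewrite mulrAC ltr_pdivrMr ?divr_gt0 // ltr_pM2l.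
have dE : e / (3 * C) * (3 * h) = e / C * h by field; rewrite gt_eqF.
have eC1 : e / C < 1 by rewrite ltr_pdivrMr // mul1r.
have eCh : e / C * h < h by rewrite gtr_pMl.
exists (3 * h), l; rewrite dE; move: qx0; rewrite ltr_norml => /andP[qx1 qx2].
split; [by apply/andP; split; lra | by rewrite /h in qx1 qx2 *; lra
  | by rewrite /h in qx1 qx2 eCh *; lra | ].
move=> x /andP[lx xh].
have xx0 : x <= x0 by rewrite /h in eCh xh; lra.
apply: (remainder_gap c x n) => //; first by apply/andP; split; lra.
have lx' : 0 < l <= x by rewrite l0' ltW.
have := remainder_homo c l x 1 n lx' rl; rewrite l0 => -> /=.
(* By convexity r_n(x) <= (x - l) C / h, which is at most e inside the gap. *)
have := remainder_chord c l x x0 1 n l0'.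
rewrite (ltW lx) xx0 => /(_ isT rl); rewrite l0 !subr0 -/h => hch.
have hx : remainder c x 1 n <= e.
  rewrite -(ler_pM2l h0); apply: le_trans hch _.
  apply: le_trans (_ : (x - l) * C <= _).
    by rewrite ler_wpM2l ?subr_ge0 ?(ltW lx) //; have /andP[_ hr] := cr n; apply: le_trans BC.
  have -> : h * e = e / C * h * C by field; rewrite gt_eqF.
  by rewrite ler_pM2r //; lra.
apply: le_trans hx _.
by rewrite /e lerD2r ler_pM2l ?lef_pV2 ?posrE; lra.
Qed.

(** At a density point the proportion of K in small balls tends to 1, whereas porosity keeps it at
    most 1 - d/2 at arbitrarily small radii. *)
Lemma closed_porous_negligible {R : realType} (K : set R) : closed K ->
  (@lebesgue_measure R).-negligible (K `&` porous_at K).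
Proof.
move=> cK; have mK := measurable_realfun.closed_measurable cK.
apply: negligibleS (lebesgue_density mK) => q [Kq [d d0 hd]] /= cvg1.
move: cvg1; rewrite indicE mem_set // => /fine_cvg /cvgr_gt.
have d1 : 1 - d / 2 < 1%:R :> R by lra.
move=> /(_ _ d1)[e /= e0 he].
have [r [l [/andP[r0 re] ql lq gap]]] := hd e e0.
have := he r; rewrite /= sub0r normrN gtr0_norm // => /(_ re r0).
rewrite ltNge => /negP; apply.
have r20 : 0 < r *+ 2 by rewrite mulrn_wgt0.
rewrite lebesgue_measure_ball ?(ltW r0) //.
(* [A1] and [A2] are what remains of the ball once the gap is removed, of total length 2r - dr. *)
pose A1 : set R := `](q - r), l]%classic.
pose A2 : set R := `[(l + d * r), (q + r)[%classic.
have ub : (lebesgue_measure (K `&` ball q r) <= (2 * r - d * r)%:E)%E.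
  apply: (@le_trans _ _ (lebesgue_measure (A1 `|` A2))).
    apply: le_measure; rewrite ?inE.
    - by apply: measurableI => //; exact: measurable_realfun.measurable_ball.
    - by apply: measurableU; exact: measurable_itv.
    - move=> x [Kx]; rewrite /ball /= ltr_norml => /andP[h1 h2].
      have [xl|xl] := leP x l; [left | right]; rewrite /A1 /A2 /= in_itv /=.
        by apply/andP; split; lra.
      have [xr|xr] := leP (l + d * r) x; first by apply/andP; split; lra.
      by exfalso; apply: (gap x) => //; rewrite xl.
  apply: (@le_trans _ _ (lebesgue_measure A1 + lebesgue_measure A2)%E).
    by apply: measureU2; exact: measurable_itv.
  rewrite /A1 /A2 !lebesgue_measure_itv /= !lte_fin ql lq -!EFinB -EFinD lee_fin.
  lra.
have fin : lebesgue_measure (K `&` ball q r) \is a fin_num.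
  rewrite ge0_fin_numE ?measure_ge0 //; exact: le_lt_trans ub (ltry _).
rewrite -(fineK fin) inver gt_eqF // -EFinM /= ler_pdivrMr //.
move: ub; rewrite -(fineK fin) lee_fin /= -mulr_natl; lra.
Qed.

Lemma univoque_bases_closure_null {R : realType} {M : nat} : (1 <= M)%N ->
  lebesgue_measure (closure (univoque_bases R M)) = 0%E.
Proof.
move=> M1; set K := closure _; have cK : closed K by exact: closed_closure.
apply: measure_negligible; first exact: measurable_realfun.closed_measurable.
(* The endpoints 1 and M+1, where porosity has not been established, are added as two null
   points. *)
pose A : set R := K `&` porous_at K `|` ([set 1] `|` [set M%:R + 1]).
apply: (@negligibleS _ _ _ (@lebesgue_measure R) A); last first.
  apply: negligibleU; first exact: closed_porous_negligible.
  by apply: negligibleU; apply/negligibleP => //; exact: lebesgue_measure_set1.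
move=> q Kq.
have : (`[1, M%:R + 1]%classic : set R) q.
  suff : K `<=` `[1, M%:R + 1] by apply.
  rewrite [X in _ `<=` X](closure_id _).1; last exact: interval_closed.
  apply: closureS => x /univoque_bases_bounds /andP[x1 xM] /=.
  by rewrite in_itv /= xM ltW.
rewrite /= in_itv /= !le_eqVlt => /andP[/predU1P[q1|q1]]; first by right; left; exact: esym.
move=> /predU1P[qM|qM]; first by right; right.
left; split => //.
have [|d d0 hd] := univoque_closure_porous q M1 _ Kq; first by rewrite q1.
(* The gaps are open intervals, so a gap of U is also a gap of its closure. *)
exists d => // r0 /hd[r [l [h1 h2 h3 h4]]]; exists r, l; split => // x xI Kx.
have [|y [Uy /=]] := Kx `]l, l + d * r[%classic.
  by apply: near_in_itvoo; rewrite in_itv.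
by rewrite in_itv /= => yI; exact: h4 yI Uy.
Qed.

Lemma univoque_bases_null {R : realType} {M : nat} : (1 <= M)%N ->
  lebesgue_measure (univoque_bases R M) = 0%E.
Proof.
move=> M1; apply/eqP; rewrite eq_le; apply/andP; split.
  rewrite -(univoque_bases_closure_null M1).
  by apply: le_mu_ext; exact: subset_closure.
exact: mu_ext_ge0.
Qed.

(** * Univoque bases with prescribed digits *)

(** q is the least x >= 1 with all r_n(x) >= 0. If r_n(q) exceeded M/(q-1), the same would hold at
    some x < q; from there the remainders stay above M/(x-1), hence nonnegative, against
    minimality. *)
Lemma base_exists {R : realType} {M : nat} (c : nat -> 'I_M.+1) :
  (1 <= M)%N -> c 0%N = ord_max -> c 1%N = ord_max ->
  exists2 q : R, 3 / 2 <= q <= M%:R + 1 &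
    forall n, 0 <= remainder c q 1 n <= M%:R / (q - 1).
Proof.
move=> M1 c0 c1; have M1' : 1 <= M%:R :> R by rewrite ler1n.
pose E := [set x : R | 1 <= x /\ forall n, 0 <= remainder c x 1 n].
have EM : E (M%:R + 1).
  split=> [|n]; first lra.
  suff : 1 <= remainder c (M%:R + 1) (1 : R) n by apply: le_trans.
  elim: n => [//|n IH] /=; have := @digit_le R M (c n); nra.
have iE : has_inf E by split; [exists (M%:R + 1) | exists 1 => x []].
pose q := inf E.
have qlb x : E x -> q <= x by apply: ge_inf; case: iE.
have q1 : 1 <= q by apply: lb_le_inf; [case: iE | move=> x []].
have qM : q <= M%:R + 1 by exact: qlb.
have q0 n : 0 <= remainder c q 1 n.
  rewrite leNgt; apply/negP => h.
  have [e /= e0 he] := @cvgr_lt _ _ _ _ _ _ (@remainder_continuous R M c 1 n q) 0 h.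
  have [x Ex xq] := inf_adherent e0 iE.
  have qx := qlb _ Ex.
  have : remainder c x 1 n < 0.
    apply: he; rewrite /= distrC ger0_norm ?subr_ge0 // ltrBlDl //.
  by have [_ /(_ n)] := Ex; lra.
(* r_2(q) = q^2 - M q - M >= 0 fails for 1 <= q < 3/2. *)
have q32 : 3 / 2 <= q.
  by have := q0 2%N; rewrite /= c0 c1 /=; nra.
exists q; first by rewrite q32.
move=> n; rewrite q0 /= leNgt; apply/negP; rewrite ltr_pdivrMr; last lra.
move=> h; rewrite mulrC in h.
have ct : continuous (fun x : R => (x - 1) * remainder c x 1 n).
  move=> x; apply: cvgM; last exact: remainder_continuous.
  by apply: cvgB; [exact: cvg_id | exact: cvg_cst].
have [e /= e0 he] := @cvgr_gt _ _ _ _ _ _ (ct q) _ h.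
(* The shift is at most 1/8, so x > 1 still holds. *)
pose x := q - Num.min e (1 / 4) / 2.
have m0 : 0 < Num.min e (1 / 4) by rewrite lt_min e0; lra.
have me : Num.min e (1 / 4) <= e by rewrite ge_min lexx.
have m4 : Num.min e (1 / 4) <= 1 / 4 by rewrite ge_min lexx orbT.
have xn : M%:R < (x - 1) * remainder c x 1 n.
  by apply: he; rewrite /x /= opprB addrC subrK ger0_norm; lra.
have x1 : 1 < x by rewrite /x; lra.
have x10 : 0 < x - 1 by lra.
have xk k : M%:R < (x - 1) * remainder c x 1 (n + k).
  elim: k => [|k IH]; first by rewrite addn0.
  by rewrite addnS /=; have := @digit_le R M (c (n + k)%N); nra.
have rk k : 0 <= remainder c x 1 (n + k).
  by rewrite ltW // -(pmulr_rgt0 _ x10) (lt_trans _ (xk k)) //; lra.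
suff /qlb : E x by rewrite /x; lra.
split=> [|k]; first exact: ltW.
by apply: remainder_ge0W (rk k); [lra | exact: leq_addl].
Qed.

(** Where a competitor first differs, a larger digit makes its remainder negative and a smaller one
    pushes it above M/(q-1). *)
Lemma univoque_criterion {R : realType} {M : nat} (c : nat -> 'I_M.+1) (q : R) :
  1 < q -> (forall n, 0 <= remainder c q 1 n <= M%:R / (q - 1)) ->
  (forall n, (c n < M)%N -> remainder c q 1 n.+1 < 1) ->
  (forall n, (0 < c n)%N -> M%:R / (q - 1) - remainder c q 1 n.+1 < 1) ->
  univoque_bases R M q.
Proof.
move=> q1 cr hM h0; split=> //; exists c; split.
  by apply: (@remainder_expansion _ _ _ _ _ (M%:R / (q - 1)) 0%N).
move=> d /(expansion_remainder _ _ _ q1) dr.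
suff h n : forall i, (i < n)%N -> c i = d i by apply/funext => i; exact: (h i.+1).
elim: n => [//|n IH] i; rewrite ltnS leq_eqVlt => /predU1P[->{i}|]; last exact: IH.
have e := eq_remainder _ _ q 1 _ IH.
have /andP[d0 dB] := dr n.+1; rewrite /= -e in d0 dB.
have [cd|dc|/val_inj//] := ltngtP (c n) (d n).
  have cM : (c n < M)%N by apply: leq_trans cd _; rewrite -ltnS.
  have := hM _ cM; rewrite /=.
  have : (c n)%:R + 1 <= (d n)%:R :> R by rewrite natr1 ler_nat.
  by move=> h1 h2; exfalso; lra.
have c0 : (0 < c n)%N by apply: leq_ltn_trans dc.
have := h0 _ c0; rewrite /=.
have : (d n)%:R + 1 <= (c n)%:R :> R by rewrite natr1 ler_nat.
by move=> h1 h2; exfalso; lra.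
Qed.

(** The digit at n+k is at least 1, and each step back to n divides the lower bound by at most q. *)
Lemma remainder_ge {R : realType} {M : nat} (c : nat -> 'I_M.+1) (q y : R) n k :
  0 < q -> (forall n, 0 <= remainder c q y n) -> (0 < c (n + k))%N ->
  (q ^+ k.+1)^-1 <= remainder c q y n.
Proof.
move=> q0 cr; elim: k n => [|k IH] n.
  rewrite addn0 -(ler_nat R) => cn; have := cr n.+1; rewrite /= subr_ge0 => h.
  by rewrite expr1 -div1r ler_pdivrMr // mulrC (le_trans cn).
rewrite -addSnnS => /IH h; rewrite exprS invfM mulrC ler_pdivrMr //.
apply: le_trans h _; rewrite /= mulrC gerBl //.
Qed.

(** Reflecting the digits to M - c_i turns upper bounds on remainders into lower bounds. *)
Lemma remainder_rev {R : realType} {M : nat} (c : nat -> 'I_M.+1) (q y : R) n :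
  1 < q ->
  remainder (fun i => rev_ord (c i)) q (M%:R / (q - 1) - y) n
  = M%:R / (q - 1) - remainder c q y n.
Proof.
move=> q1; elim: n => [//|n IH] /=; rewrite IH subSS natrB; last by rewrite -ltnS ltn_ord.
by field; rewrite subr_eq0 gt_eqF.
Qed.

(** No N consecutive zeros anywhere, and no N consecutive digits M after the initial run of 2N of
    them. *)
Definition tame {M : nat} (N : nat) (c : nat -> 'I_M.+1) : Prop :=
  [/\ forall i, (i < 2 * N)%N -> c i = ord_max,
      forall n, exists2 k, (k < N)%N & (0 < c (n + k))%N &
      forall n, (2 * N <= n)%N -> exists2 k, (k < N)%N & (c (n + k) < M)%N].

(** With B = M/(q-1) and w = q^N, the absence of long zero runs gives r_n >= 1/w, and by reflection
    B - r_(n+1) >= 1/w after a digit below M. The initial run makes B - 1 < 1/w, so both conditions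
    of the uniqueness criterion follow. *)
Lemma tame_base {R : realType} {M : nat} (N : nat) (c : nat -> 'I_M.+1) :
  (1 <= M)%N -> (2 <= N)%N -> tame N c ->
  exists2 q : R, univoque_bases R M q &
    [/\ 0 < q <= M%:R + 1, forall n, `|remainder c q 1 n| <= 2,
        forall n, (c n < M)%N -> remainder c q 1 n.+1 < 1 &
        forall n, ((M%:R + 1) ^+ N)^-1 <= remainder c q 1 n].
Proof.
move=> M1 N2 [cM c0 c1].
have [||q /andP[q32 qM] cr] := @base_exists R M c M1; try by apply: cM; lia.
set B := M%:R / (q - 1) in cr.
have q1 : 1 < q by lra.
have q0 : 0 < q by lra.
have cr0 n : 0 <= remainder c q 1 n by have /andP[] := cr n.
pose c' i := rev_ord (c i).
have c'E n : remainder c' q (B - 1) n = B - remainder c q 1 n by exact: remainder_rev.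
have c'0 n : 0 <= remainder c' q (B - 1) n by rewrite c'E subr_ge0; have /andP[] := cr n.
pose w := q ^+ N.
have w94 : 9 / 4 <= w.
  apply: (@le_trans _ _ (q ^+ 2)); first by rewrite expr2; nra.
  by rewrite ler_weXn2l // ltW.
have qN k : (k < N)%N -> w^-1 <= (q ^+ k.+1)^-1.
  by move=> kN; rewrite lef_pV2 ?posrE ?exprn_gt0 // ler_weXn2l // ltW.
(* The first 2N reflected digits are 0, so the reflected remainder there is w^2 (B - 1), and it is
   at most B. *)
have Bw : B - 1 < w^-1.
  have := c'E (2 * N)%N; rewrite remainder_all0; last first.
    by move=> i /cM; rewrite /c' => -> /=; rewrite subnn.
  rewrite mulnC exprM -/w => h.
  have {h} : w ^+ 2 * (B - 1) <= B by rewrite h gerBl.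
  rewrite -div1r ltr_pdivlMr; last lra.
  rewrite expr2 -mulrA [w * (B - 1)]mulrC; move: (B - 1) (subrK 1 B) => v <- hv.
  rewrite ltNge; apply/negP => vw.
  have v0 : 0 < v by rewrite -(pmulr_lgt0 _ (_ : 0 < w)); lra.
  have : 0 <= (w - 9 / 4) * (v * w) by apply: mulr_ge0; lra.
  have : 0 <= (w - 9 / 4) * v by apply: mulr_ge0; lra.
  lra.
have lo n : w^-1 <= remainder c q 1 n.
  have [k kN ck] := c0 n; apply: le_trans (qN _ kN) _.
  exact: remainder_ge.
have hi n : (c n < M)%N -> remainder c q 1 n.+1 < 1.
  move=> cn; have nN : (2 * N <= n)%N.
    by rewrite leqNgt; apply/negP => /cM h; rewrite h /= ltnn in cn.
  have [k kN ck] := c1 n.+1 (leqW nN).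
  suff : w^-1 <= B - remainder c q 1 n.+1 by lra.
  rewrite -c'E; apply: le_trans (qN _ kN) _.
  by apply: remainder_ge => //; rewrite /c' /= subSS subn_gt0.
have w1 : w^-1 <= 1 by rewrite invf_le1; lra.
have B2 : B <= 2 by move: Bw w1; move: (w^-1) => v; lra.
exists q.
  apply: (univoque_criterion c q q1 cr hi) => n _; rewrite -/B ltrBlDl -ltrBlDr.
  exact: lt_le_trans Bw (lo _).
split=> //.
- by rewrite q0.
- by move=> n; have /andP[h1 h2] := cr n; rewrite ger0_norm // (le_trans h2).
- have b0 : 0 < M%:R + 1 :> R by lra.
  move=> n; apply: le_trans (lo n); rewrite lef_pV2 ?posrE ?exprn_gt0 //.
  by apply: lerXn2r; rewrite ?nnegrE // ltW.
Qed.

(** For the digits c, r_(m+1) is below 1 at q but at least 1 + (M+1)^-N at q', since c' has a larger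
    digit at m. The Lipschitz bound turns this difference into a distance of bases. *)
Lemma base_separation {R : realType} {M : nat} (N m : nat) (c c' : nat -> 'I_M.+1)
    (q q' : R) :
  (1 <= M)%N ->
  0 <= q' <= M%:R + 1 -> (forall n, `|remainder c q 1 n| <= 2) ->
  (forall n, (c n < M)%N -> remainder c q 1 n.+1 < 1) ->
  (forall n, ((M%:R + 1) ^+ N)^-1 <= remainder c' q' 1 n) ->
  (forall i, (i < m)%N -> c i = c' i) -> (c m < c' m)%N ->
  ((M%:R + 1) ^+ N)^-1 <= 2 * (M%:R + 1) ^+ m.+1 * `|q' - q|.
Proof.
move=> M1 q'M c2 c1 c'N cc' cm.
have lip := remainder_lipschitz c 2 q' q 1 m.+1 M1 q'M (fun i _ => c2 i).
apply: le_trans (_ : `|remainder c q' 1 m.+1 - remainder c q 1 m.+1| <= _).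
  apply: le_trans (ler_norm _).
  have cM : (c m < M)%N by apply: leq_trans cm _; rewrite -ltnS.
  have h1 := c1 _ cM; have := c'N m.+1.
  rewrite [remainder c' _ _ _]/= [remainder c q' 1 _]/= (eq_remainder _ _ _ _ _ cc').
  have : (c m)%:R + 1 <= (c' m)%:R :> R by rewrite natr1 ler_nat.
  lra.
apply: le_trans lip _; rewrite ler_wpM2r // ler_wpM2l // gerBl //.
Qed.

(* The digits of z, cut into words w of length N - 2, are written as the blocks
   0 w M after an initial run of 2N digits M. *)
Definition coded {M : nat} (N : nat) (z : nat -> 'I_M.+1) (i : nat) : 'I_M.+1 :=
  if (i < 2 * N)%N then ord_max else
  let k := (i - 2 * N)%N in
  if (k %% N == 0)%N then ord0 else
  if (k %% N == N.-1)%N then ord_max else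
  z (k %/ N * (N - 2) + (k %% N).-1)%N.

(** Past the initial run, any N consecutive positions meet both a block start 0 and a block end
    M. *)
Lemma coded_tame {M : nat} (N : nat) (z : nat -> 'I_M.+1) :
  (1 <= M)%N -> (3 <= N)%N -> tame N (coded N z).
Proof.
move=> M1 N3; have N0 : (0 < N)%N by lia.
split.
- by move=> i iN; rewrite /coded iN.
- move=> n; have [nN|nN] := ltnP n (2 * N).
    by exists 0%N; rewrite // addn0 /coded nN.
  have rN := ltn_pmod (n - 2 * N) N0.
  exists (N.-1 - (n - 2 * N) %% N)%N; first by lia.
  rewrite /coded [(_ < 2 * N)%N]ltnNge (leq_trans nN) ?leq_addr //=.
  have -> : ((n + (N.-1 - (n - 2 * N) %% N) - 2 * N) %% N)%N = N.-1.
    rewrite -addnBAC // {1}(divn_eq (n - 2 * N) N) -addnA modnMDl subnKC; last by lia.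
    by rewrite modn_small; lia.
  by rewrite eqxx; case: eqP => //; lia.
- move=> n nN; have rN := ltn_pmod (n - 2 * N) N0.
  have [r0|r0] := posnP ((n - 2 * N) %% N)%N.
    exists 0%N => //; rewrite addn0 /coded [(_ < 2 * N)%N]ltnNge nN /= r0 eqxx //.
  exists (N - (n - 2 * N) %% N)%N; first by lia.
  rewrite /coded [(_ < 2 * N)%N]ltnNge (leq_trans nN) ?leq_addr //=.
  have -> : ((n + (N - (n - 2 * N) %% N) - 2 * N) %% N)%N = 0%N.
    rewrite -addnBAC // {1}(divn_eq (n - 2 * N) N) -addnA modnMDl subnKC; last by lia.
    by rewrite modnn.
  by rewrite eqxx.
Qed.

Lemma coded_inj_prefix {M : nat} (N j : nat) (z z' : nat -> 'I_M.+1) :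
  (3 <= N)%N ->
  (forall i, (i < 2 * N + j * N)%N -> coded N z i = coded N z' i) ->
  forall i, (i < j * (N - 2))%N -> z i = z' i.
Proof.
move=> N3 h i ij; have N2 : (0 < N - 2)%N by lia.
have r := ltn_pmod i N2.
have ij' : (i %/ (N - 2) < j)%N by rewrite ltn_divLR.
have lt : (i %/ (N - 2) * N + (i %% (N - 2)).+1 < j * N)%N.
  apply: (@leq_trans ((i %/ (N - 2)).+1 * N)%N); first by rewrite mulSn; lia.
  by rewrite leq_mul2r ij' orbT.
(* The place where the digit z_i is stored; the successor skips the leading 0 of its block. *)
pose p := (2 * N + (i %/ (N - 2) * N + (i %% (N - 2)).+1))%N.
have E (y : nat -> 'I_M.+1) : coded N y p = y i.
  rewrite /coded /p ltnNge leq_addr /= addKn.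
  have rN : ((i %% (N - 2)).+1 < N)%N by lia.
  rewrite modnMDl divnMDl ?(modn_small rN) ?(divn_small rN) /= ?addn0; last by lia.
  by rewrite -divn_eq ifF //; lia.
by rewrite -(E z) -(E z') h // /p ltn_add2l.
Qed.

(** In base M+1 the remainders lie in [0, 1], and those of t and t' at n differ by (M+1)^n (t -
    t'). *)
Lemma expansion_prefix_dist {R : realType} {M : nat} (z z' : nat -> 'I_M.+1)
    (t t' : R) n : (1 <= M)%N ->
  is_expansion (M%:R + 1) t z -> is_expansion (M%:R + 1) t' z' ->
  (forall i, (i < n)%N -> z i = z' i) ->
  `|t - t'| <= ((M%:R + 1) ^+ n)^-1.
Proof.
move=> M1 tz tz' zz'; have M1' : 1 <= M%:R :> R by rewrite ler1n.
have b1 : 1 < M%:R + 1 :> R by lra.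
have := expansion_remainder _ _ _ b1 tz n.
have := expansion_remainder _ _ _ b1 tz' n.
rewrite addrK divff; last by lra.
rewrite -(eq_remainder _ _ _ _ _ zz').
have bn : 0 < (M%:R + 1 : R) ^+ n by rewrite exprn_gt0 //; lra.
have := remainder_sub z (M%:R + 1) t t' n.
move: (remainder _ _ _ _) (remainder _ _ _ _) => u v huv /andP[v0 v1] /andP[u0 u1].
rewrite -(ler_pM2l bn) divff ?gt_eqF // -[X in X * _]gtr0_norm // -normrM -huv.
by rewrite ler_norml; apply/andP; split; lra.
Qed.

(** [psi] sends t to a base in which the coded base-(M+1) digits of t expand 1; it is a right
    inverse of the Hoelder map onto [0, 1]. *)
Lemma univoque_holder_param {R : realType} {M : nat} (s : R) :
  (1 <= M)%N -> 0 <= s < 1 ->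
  exists (psi : R -> R) (C : R), [/\ 0 < C,
    forall t, 0 <= t <= 1 -> univoque_bases R M (psi t) &
    forall t t', 0 <= t <= 1 -> 0 <= t' <= 1 ->
      `|t - t'| <= C * `|psi t - psi t'| `^ s].
Proof.
have arith (m N j : nat) :
    (m < 2 * N + j.+1 * N)%N -> (m.+1 + N <= j * N + 4 * N)%N.
  by rewrite mulSn; lia.
move=> M1 /andP[s0 s1]; have M1' : 1 <= M%:R :> R by rewrite ler1n.
set b : R := M%:R + 1; have b1 : 1 < b by rewrite /b; lra.
have b0 : 0 < b by lra.
have bn k : 0 < b ^+ k by rewrite exprn_gt0.
(* N > 2/(1-s) makes the exponent (N-2)/N at least s. *)
have [N N3 Ns] : exists2 N, (3 <= N)%N & N%:R * s <= (N - 2)%:R.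
  exists (Num.trunc (2 / (1 - s))).+3 => //.
  have := truncnS_gt (2 / (1 - s)); rewrite ltr_pdivrMr ?subr_gt0 //.
  rewrite !subSS subn0 -!natr1 => h; nra.
have digits (t : R) : exists z : nat -> 'I_M.+1,
    0 <= t <= 1 -> is_expansion b t z.
  have [ht|ht] := boolP (0 <= t <= 1); last by exists (fun=> ord0).
  have [||z zt] := @expansion_exists R M b t; [by rewrite b1 /= | | by exists z].
  by rewrite /b addrK divff //; lra.
have [z zP] := choice digits.
have N2 : (2 <= N)%N by exact: ltnW.
have bases (t : R) := @tame_base R M N _ M1 N2 (coded_tame N (z t) M1 N3).
pose psi t := s2val (cid2 (bases t)).
have psiU t : univoque_bases R M (psi t) by rewrite /psi; case: (cid2 (bases t)).
have psiP t : [/\ 0 < psi t <= b, forall n, `|remainder (coded N (z t)) (psi t) 1 n| <= 2,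
        forall n, (coded N (z t) n < M)%N -> remainder (coded N (z t)) (psi t) 1 n.+1 < 1 &
        forall n, (b ^+ N)^-1 <= remainder (coded N (z t)) (psi t) 1 n].
  by rewrite /psi; case: (cid2 (bases t)).
pose A := 2 * b ^+ (4 * N).
have A0 : 0 < A by rewrite mulr_gt0.
exists psi, (A `^ s); split; [exact: powR_gt0 | by move=> t _ |].
move=> t t' ht ht'.
have [->|tt'] := eqVneq t t'; first by rewrite subrr normr0 mulr_ge0 ?powR_ge0.
have ex : exists m, coded N (z t) m != coded N (z t') m.
  apply: contrapT => hn; move/eqP: tt'; apply.
  have zz : z t = z t'.
    apply/funext => i.
    apply: (coded_inj_prefix N i.+1 (z t) (z t') N3) => [k _|]; last first.
      by rewrite leq_pmulr //; lia.
    by apply/eqP; apply: contrapT => /negP hk; apply: hn; exists k.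
  have := zP _ ht'; rewrite -zz; have := zP _ ht; rewrite /is_expansion => c1 c2.
  by rewrite -(cvg_lim _ c1) // -(cvg_lim _ c2).
case: (ex_minnP ex) => m hm mmin.
have pre i : (i < m)%N -> coded N (z t) i = coded N (z t') i.
  by move=> im; apply/eqP; apply: contraTT im => /mmin; rewrite -leqNgt.
have mN : (2 * N <= m)%N.
  by rewrite leqNgt; apply/negP => h; move: hm; rewrite /coded h eqxx.
(* The number of complete blocks before the first difference m: they fix j (N-2) digits of t, while
   m < (j+3) N bounds the separation of the bases. *)
pose j := ((m - 2 * N) %/ N)%N.
have jm : (2 * N + j * N <= m)%N.
  by rewrite -leq_subRL // /j leq_trunc_div.
have mj : (m < 2 * N + j.+1 * N)%N.
  by rewrite -{1}(subnKC mN) ltn_add2l /j ltn_ceil // (leq_trans _ N3).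
have zpre i : (i < j * (N - 2))%N -> z t i = z t' i.
  by apply: (coded_inj_prefix N j _ _ N3) => k kj; apply: pre; exact: leq_trans jm.
have dist := expansion_prefix_dist _ _ _ _ _ M1 (zP _ ht) (zP _ ht') zpre.
apply: le_trans dist _.
have sep : (b ^+ N)^-1 <= 2 * b ^+ m.+1 * `|psi t - psi t'|.
  have [/andP[p0 pb] p2 p1 pN] := psiP t; have [/andP[p0' pb'] p2' p1' pN'] := psiP t'.
  have [h|h|/val_inj h] := ltngtP (coded N (z t) m) (coded N (z t') m).
  - rewrite distrC.
    by apply: (base_separation N m (coded N (z t)) (coded N (z t'))) => //; rewrite pb' ltW.
  - apply: (base_separation N m (coded N (z t')) (coded N (z t))) => //.
      by rewrite pb ltW.
    by move=> i im; rewrite pre.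
  - by rewrite h eqxx in hm.
set D := `|_| in sep *.
have D0 : 0 <= D by exact: normr_ge0.
have sep' : 1 <= b ^+ (j * N) * (A * D).
  move: sep; rewrite -div1r ler_pdivrMr // => sep; apply: le_trans sep _.
  have : b ^+ m.+1 * b ^+ N <= b ^+ (j * N) * b ^+ (4 * N).
    rewrite -!exprD ler_weXn2l ?(ltW b1) //; exact: arith.
  move=> h; rewrite /A.
  have -> : 2 * b ^+ m.+1 * D * b ^+ N = (b ^+ m.+1 * b ^+ N) * (2 * D) by ring.
  have -> : b ^+ (j * N) * (2 * b ^+ (4 * N) * D) = (b ^+ (j * N) * b ^+ (4 * N)) * (2 * D).
    by ring.
  by rewrite ler_wpM2r // mulr_ge0.
have pw : (b ^+ (j * N)) `^ s <= b ^+ (j * (N - 2)).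
  rewrite -!powR_mulrn ?(ltW b0) // -powRrM ler_powR ?(ltW b1) // !natrM -mulrA.
  by rewrite ler_wpM2l.
have : 1 `^ s <= (b ^+ (j * N) * (A * D)) `^ s.
  by apply: ge0_ler_powR; rewrite ?nnegrE // !mulr_ge0 // ltW.
have AD0 : 0 <= A * D by apply: mulr_ge0 => //; exact: ltW.
rewrite powR1 (powRM s (ltW (bn _)) AD0) (powRM s (ltW A0) D0) => h1.
rewrite -div1r ler_pdivrMr // mulrC; apply: le_trans h1 _.
by rewrite ler_wpM2r // mulr_ge0 ?powR_ge0.
Qed.

(** * Hausdorff dimension *)

Lemma diam_ge0 {R : realType} (A : set R) : (0 <= diam A)%E.
Proof. by apply: ereal_sup_ubound; left. Qed.

Lemma diam_le {R : realType} (A : set R) (e : \bar R) : (0 <= e)%E ->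
  (forall x y, A x -> A y -> (`|x - y|%:E <= e)%E) -> (diam A <= e)%E.
Proof.
move=> e0 h; apply: ge_ereal_sup => _ [->//|[x [y [Ax Ay ->]]]]; exact: h.
Qed.

Lemma le_diam {R : realType} (A : set R) (x y : R) : A x -> A y ->
  (`|x - y|%:E <= diam A)%E.
Proof. by move=> Ax Ay; apply: ereal_sup_ubound; right; exists x, y. Qed.

Lemma diam_pow_ge0 {R : realType} (s : R) (A : set R) : (0 <= diam_pow s A)%E.
Proof. by rewrite /diam_pow; case: ifP => // _; exact: poweR_ge0. Qed.

Lemma hausdorff_premeasure_ge0 {R : realType} (s d : R) (A : set R) :
  (0 <= hausdorff_premeasure s d A)%E.
Proof.
apply: le_ereal_inf_tmp => _ [F _ <-].
by apply: nneseries_ge0 => n _ _; exact: diam_pow_ge0.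
Qed.

Lemma ocitv_diam_le {R : realType} (A : set R) : ocitv A ->
  (diam A <= wlength idfun A)%E.
Proof.
move=> [[a b] _ <- /=]; apply: diam_le; first exact: wlength_itv_ge0.
move=> x y /=; rewrite !in_itv /= => /andP[ax xb] /andP[ay yb].
have ab : a <= b by exact: ltW (lt_le_trans ax xb).
rewrite wlength_itv_bnd // lee_fin ler_norml.
by apply/andP; split; rewrite /=; lra.
Qed.

(** The half-open intervals defining the Lebesgue outer measure also serve as Hausdorff covers,
    their diameters being at most their lengths. *)
Lemma null_hausdorff_measure1 {R : realType} (A : set R) :
  lebesgue_measure A = 0%E -> hausdorff_measure 1 A = 0%E.
Proof.
move=> A0.
suff pre d : 0 < d -> hausdorff_premeasure 1 d A = 0%E.
  rewrite /hausdorff_measure; apply/eqP; rewrite eq_le; apply/andP; split.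
    by apply: ge_ereal_sup => _ [d d0 <-]; rewrite pre.
  by apply: ereal_sup_ubound; exists 1 => //=; exact: pre.
move=> d0; apply/eqP; rewrite eq_le hausdorff_premeasure_ge0 andbT.
apply/lee_addgt0Pr => e e0; rewrite add0e.
(* Total length below d makes every single diameter at most d; below e, it bounds the sum. *)
have m0 : 0 < Num.min d e by rewrite lt_min d0.
have : (lebesgue_measure A < (Num.min d e)%:E)%E by rewrite A0 lte_fin.
move=> /ereal_inf_lt[_ [F [mF AF] <-] Fde].
have w0 (n : nat) : (0 <= wlength idfun (F n))%E.
  by have [[a b] _ <-] := mF n; exact: wlength_itv_ge0.
have Fd n : (diam (F n) <= wlength idfun (F n))%E by apply: ocitv_diam_le; exact: mF.
have wle n : (wlength idfun (F n) <= d%:E)%E.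
  apply: le_trans (_ : \sum_(0 <= k <oo) wlength idfun (F k) <= _)%E.
    apply: le_trans (nneseries_lim_ge n.+1 (fun k _ _ => w0 k)).
    by rewrite big_nat_recr //= leeDr // sume_ge0.
  by apply: le_trans (ltW Fde) _; rewrite lee_fin ge_min lexx.
apply: (@le_trans _ _ (\sum_(0 <= k <oo) diam_pow 1 (F k))%E).
  apply: ereal_inf_lbound; exists F => //; split => // k.
  exact: le_trans (Fd k) (wle k).
apply: (@le_trans _ _ (\sum_(0 <= k <oo) wlength idfun (F k))%E).
  apply: lee_nneseries => [n _ _|n _]; first exact: diam_pow_ge0.
  rewrite /diam_pow; case: ifP => // _; rewrite poweRe1 //; exact: diam_ge0.
by apply: le_trans (ltW Fde) _; rewrite lee_fin ge_min lexx orbT.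
Qed.

(** Parameters sent by [psi] into one set F_k lie in an interval of length 2C |F_k|^s. These
    intervals cover [0, 1], so the sum of |F_k|^s is at least 1/(2C). *)
Lemma holder_hausdorff_measure {R : realType} (A : set R) (psi : R -> R) (s C : R) :
  0 < C -> (forall t, 0 <= t <= 1 -> A (psi t)) ->
  (forall t t', 0 <= t <= 1 -> 0 <= t' <= 1 ->
     `|t - t'| <= C * `|psi t - psi t'| `^ s) ->
  0 <= s -> hausdorff_measure s A != 0%E.
Proof.
move=> C0 psiA holder s0.
have C20 : 0 < 2 * C by rewrite mulr_gt0.
suff : ((2 * C)^-1%:E <= hausdorff_measure s A)%E.
  move=> h; apply/eqP => A0; move: h; rewrite A0 lee_fin leNgt => /negP; apply.
  by rewrite invr_gt0.
apply: (@le_trans _ _ (hausdorff_premeasure s 1 A)); last first.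
  by apply: ereal_sup_ubound; exists 1 => //=.
apply: le_ereal_inf_tmp => _ [F [AF dF] <-].
have /choice[B BP] (k : nat) : exists B : set (measurableTypeR R), [/\ measurable B,
    forall t : R, 0 <= t <= 1 -> F k (psi t) -> B t &
    (lebesgue_measure B <= (2 * C)%:E * diam_pow s (F k))%E].
  (* The interval is centred at any parameter sent into F_k; if there is none, the empty set
     serves. *)
  have [[t [t01 Ft]]|hn] := pselect (exists t, 0 <= t <= 1 /\ F k (psi t)); last first.
    exists set0; split => //; first by move=> t t01 Ft; apply: hn; exists t.
    by rewrite measure0 mule_ge0 ?diam_pow_ge0 // lee_fin ltW.
  pose e := fine (diam (F k)).
  have fin : diam (F k) \is a fin_num.
    by rewrite ge0_fin_numE ?diam_ge0 // (le_lt_trans (dF k)) // ltry.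
  have eE : diam (F k) = e%:E by rewrite /e fineK.
  have e0 : 0 <= e by rewrite -lee_fin -eE diam_ge0.
  pose r := C * e `^ s.
  have r0 : 0 <= r by rewrite mulr_ge0 ?powR_ge0 // ltW.
  exists `[t - r, t + r]%classic; split; first exact: measurable_itv.
    move=> u u01 Fu; rewrite /= in_itv /=.
    have : `|t - u| <= r.
      apply: le_trans (holder _ _ t01 u01) _; rewrite ler_pM2l //.
      apply: ge0_ler_powR; rewrite ?nnegrE //.
      by rewrite -lee_fin -eE; exact: le_diam.
    by rewrite ler_norml => /andP[h1 h2]; apply/andP; split; lra.
  have -> : diam_pow s (F k) = (e `^ s)%:E.
    rewrite /diam_pow asboolF ?eE // => F0; by rewrite F0 in Ft.
  rewrite lebesgue_measure_itv /= lte_fin -EFinM.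
  case: ifP => _; last by rewrite lee_fin mulr_ge0 ?powR_ge0 // ltW.
  by rewrite -EFinB lee_fin /r; lra.
have mB k : measurable (B k) by have [] := BP k.
pose I : set R := `[0, 1]%classic.
have cov : I `<=` \bigcup_k B k.
  move=> t /=; rewrite /I /= in_itv /= => t01.
  have [k _ Fk] := AF _ (psiA _ t01).
  by exists k => //; have [_ h _] := BP k; exact: h.
have h1 : (lebesgue_measure I <= \sum_(0 <= k <oo) lebesgue_measure (B k))%E.
  by apply: measure_sigma_subadditive => //; exact: measurable_itv.
have I1 : lebesgue_measure I = 1%E.
  by rewrite /I lebesgue_measure_itv /= lte_fin ltr01 -EFinB subr0.
rewrite I1 in h1.
have h2 : (1 <= (2 * C)%:E * \sum_(0 <= k <oo) diam_pow s (F k))%E.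
  apply: le_trans h1 _; rewrite -nneseriesZl; last by move=> k _; exact: diam_pow_ge0.
  apply: lee_nneseries => [k _ _|k _]; first exact: measure_ge0.
  by have [] := BP k.
by rewrite -[X in (X <= _)%E]mule1 lee_pdivrMl.
Qed.

(** Nullity gives dimension at most 1, and the parametrization inside U excludes every s < 1.
    Allowing any null superset of U treats U and its closure together. *)
Lemma univoque_hausdorff_dim {R : realType} {M : nat} (A : set R) : (1 <= M)%N ->
  univoque_bases R M `<=` A -> lebesgue_measure A = 0%E -> hausdorff_dim A = 1%E.
Proof.
move=> M1 UA A0; apply/eqP; rewrite eq_le; apply/andP; split.
  apply: ereal_inf_lbound; exists 1 => //; split => //.
  exact: null_hausdorff_measure1.
apply: le_ereal_inf_tmp => _ [s [s0 sA] <-]; rewrite lee_fin leNgt; apply/negP => s1.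
have [|psi [C [C0 psiU holder]]] := @univoque_holder_param R M s M1; first by rewrite s0.
have /eqP[] : hausdorff_measure s A != 0%E; last exact: sA.
by apply: (holder_hausdorff_measure A psi s C) => // t t01; exact/UA/psiU.
Qed.

(* [lebesgue_measure] is the Caratheodory outer measure on arbitrary subsets of
   R, so its vanishing says exactly that the set is Lebesgue-null. *)
Theorem theorem1p6 (R : realType) (M : nat) (hM : (1 <= M)%N) :
  (lebesgue_measure (univoque_bases R M) = 0%E /\
   lebesgue_measure (closure (univoque_bases R M)) = 0%E) /\
  (hausdorff_dim (univoque_bases R M) = 1%E /\
   hausdorff_dim (closure (univoque_bases R M)) = 1%E).
Proof.
have U0 := @univoque_bases_null R M hM.
have K0 := @univoque_bases_closure_null R M hM.
split=> //; split; apply: (univoque_hausdorff_dim _ hM) => //.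
exact: subset_closure.
Qed.
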